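(* Let $p>0$, let $N$ be even, and let $\alpha_j=1$ for all $j=1,\dots,N$. Then there exist $C_N=\frac{N!}{2[(N/2)!]^2}$ one-parameter families of solutions $\Phi\in H^2_\Gamma$ to the stationary NLS equation $-\phi_j''+\phi_j-(p+1)|\phi_j|^{2p}\phi_j=0$ on $\mathbb{R}^+$, $j=1,\dots,N$. Each family is generated from the state $\Phi=(\phi_1,\dots,\phi_N)^T$ with $$\phi_j(x)=\begin{cases}\phi(x+a),& j=1,\dots,N/2,\\ \phi(x-a),& j=N/2+1,\dots,N,\end{cases}$$ where $\phi(x)=\operatorname{sech}^{1/p}(px)$ and $a\in\mathbb{R}$ is arbitrary, by rearranging which $N/2$ edges carry the shift $+a$ and which $N/2$ edges carry the shift $-a$.
   Context: $\Gamma$ is a star graph of $N$ half-lines $\mathbb{R}^+$ joined at the vertex $x=0$. With all $\alpha_j=1$: $H^1_\Gamma=\{\Psi\in\oplus_{j=1}^NH^1(\mathbb{R}^+):\psi_1(0)=\dots=\psi_N(0)\}$ (continuity) and $H^2_\Gamma=\{\Psi\in\oplus_{j=1}^NH^2(\mathbb{R}^+)\cap H^1_\Gamma:\sum_{j=1}^N\psi_j'(0)=0\}$ (classical Kirchhoff condition). *)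

(* Defs.v *)
From Stdlib Require Import Reals.
From Coquelicot Require Import Coquelicot.
From mathcomp Require Import all_boot.
Local Open Scope R_scope.

Set Implicit Arguments.
Unset Strict Implicit.
Unset Printing Implicit Defensive.

(* |y|^q for q > 0, with the convention |0|^q = 0
   (Stdlib's Rpower is only meaningful for a positive base). *)
Definition absPow (y q : R) : R :=
  if Req_EM_T y 0 then 0 else Rpower (Rabs y) q.

Definition phi (p x : R) : R := Rpower (/ cosh (p * x)) (/ p).

Definition sq_int (g : R -> R) : Prop :=
  ex_RInt_gen (fun x => (g x ^ 2)) (at_point 0) (Rbar_locally p_infty).

(* Classical (regular) membership in H^2(R^+), with d1, d2 the first and
   second derivatives; d1 and f are continuous up to the vertex x = 0, so
   f 0 and d1 0 are the traces psi(0), psi'(0). *)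
Definition H2_half (f d1 d2 : R -> R) : Prop :=
  (forall x, (0 < x) -> is_derive f x (d1 x) /\ is_derive d1 x (d2 x)) /\
  filterlim f (at_right 0) (locally (f 0)) /\
  filterlim d1 (at_right 0) (locally (d1 0)) /\
  sq_int f /\ sq_int d1 /\ sq_int d2.

(* Psi in H^2_Gamma (continuity at the vertex + Kirchhoff condition with all
   alpha_j = 1) solving -psi_j'' + psi_j - (p+1)|psi_j|^{2p} psi_j = 0 on R^+. *)
Definition NLS_H2_solution (p : R) (N : nat) (Psi : 'I_N -> R -> R) : Prop :=
  exists D1 D2 : 'I_N -> R -> R,
    (forall j, H2_half (Psi j) (D1 j) (D2 j)) /\
    (forall j k, Psi j 0 = Psi k 0) /\
    \big[Rplus/0]_(j < N) D1 j 0 = 0 /\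
    (forall j x, (0 < x) ->
       (- D2 j x + Psi j x - (p + 1) * absPow (Psi j x) (2 * p) * Psi j x = 0)).

Definition state (N : nat) (S : {set 'I_N}) (p a : R) : 'I_N -> R -> R :=
  fun j x => if j \in S then phi p (x + a) else phi p (x - a).

Definition nls_family (N : nat) (S : {set 'I_N}) (p : R) : ('I_N -> R -> R) -> Prop :=
  fun Psi => exists a : R, Psi = state S p a.

(* Main.v *)
(* The profile phi = sech^(1/p)(p x) solves -phi'' + phi - (p + 1) phi^(2p+1) = 0 on
   the whole line and decays like e^(-x) together with its first two derivatives, so
   every translate lies in H^2(R^+) and solves the equation edgewise.  Since phi is
   even and phi' is odd, phi(a) = phi(-a) gives continuity at the vertex, and the
   outgoing derivatives +-phi'(a) cancel in pairs when N/2 edges carry each shift.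
   Because phi attains its maximum 1 only at 0, two shift patterns S, T generate the
   same family iff T = S or T = ~: S, so the families are counted by the
   N/2-subsets containing a fixed edge: half of 'C(N, N/2). *)

Require Import Defs.
From HB Require Import structures.
From Stdlib Require Import Reals Lra Classical FunctionalExtensionality PropExtensionality.
From Coquelicot Require Import Coquelicot.
From mathcomp Require Import all_boot zify.

Set Implicit Arguments.
Unset Strict Implicit.
Unset Printing Implicit Defensive.

Local Open Scope R_scope.

Lemma cosh_gt0 x : 0 < cosh x.
Proof. rewrite /cosh; have := exp_pos x; have := exp_pos (- x); lra. Qed.

Lemma cosh_opp x : cosh (- x) = cosh x.
Proof. by rewrite /cosh Ropp_involutive Rplus_comm. Qed.

Lemma sinh_opp x : sinh (- x) = - sinh x.
Proof. rewrite /sinh Ropp_involutive; lra. Qed.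

Lemma Rabs_sinh_le_cosh x : Rabs (sinh x) <= cosh x.
Proof.
rewrite /sinh /cosh; have := exp_pos x; have := exp_pos (- x) => ? ?.
by apply: Rabs_le; lra.
Qed.

Lemma cosh_sub1 x : (cosh x - 1) * (2 * exp x) = (exp x - 1) ^ 2.
Proof. rewrite /cosh exp_Ropp; have := exp_pos x => ?; field; lra. Qed.

Lemma cosh_ge1 x : 1 <= cosh x.
Proof. have := cosh_sub1 x; have := exp_pos x; have := pow2_ge_0 (exp x - 1); nra. Qed.

Lemma cosh_eq1 x : cosh x = 1 -> x = 0.
Proof.
move=> hx; have := cosh_sub1 x; rewrite hx => hsq.
have ex1 : exp x = 1 by nra.
by rewrite -(ln_exp x) ex1 ln_1.
Qed.

Lemma phi_gt0 p x : 0 < phi p x.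
Proof. exact: exp_pos. Qed.

Lemma phi0 p : phi p 0 = 1.
Proof. by rewrite /phi /Rpower Rmult_0_r cosh_0 Rinv_1 ln_1 Rmult_0_r exp_0. Qed.

Lemma phi_opp p x : phi p (- x) = phi p x.
Proof. by rewrite /phi Ropp_mult_distr_r_reverse cosh_opp. Qed.

Lemma phi_eq1 p x : 0 < p -> phi p x = 1 -> x = 0.
Proof.
rewrite /phi /Rpower -exp_0 => hp /exp_inv /(Rmult_integral _ _) [/Rinv_neq_0_compat|]; first lra.
move=> /(congr1 exp); rewrite exp_ln ?exp_0; last exact: Rinv_0_lt_compat (cosh_gt0 _).
move=> hcosh; have /cosh_eq1 : cosh (p * x) = 1 by rewrite -(Rinv_inv (cosh _)) hcosh Rinv_1.
by move=> /(Rmult_integral _ _) [?|//]; lra.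
Qed.

Lemma phi_shift_inj p u v : 0 < p -> (forall x, phi p (x + u) = phi p (x + v)) -> u = v.
Proof.
move=> hp /(_ (- u)); rewrite Rplus_opp_l phi0 => /esym /(phi_eq1 hp); lra.
Qed.

Lemma phi_le_exp p x : 0 < p -> phi p x <= Rpower 2 (/ p) * exp (- x).
Proof.
move=> hp; have := exp_pos (p * x); have := exp_pos (- (p * x)) => ? ?.
have -> : Rpower 2 (/ p) * exp (- x) = Rpower (2 * exp (- (p * x))) (/ p).
  rewrite /Rpower ln_mult ?ln_exp -?exp_plus; try lra; congr exp; field; lra.
apply: Rle_Rpower_l; first by left; apply: Rinv_0_lt_compat.
split; first exact: Rinv_0_lt_compat (cosh_gt0 _).
rewrite exp_Ropp -(Rinv_inv 2) -Rinv_mult; apply: Rinv_le_contravar; first lra.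
rewrite /cosh; lra.
Qed.

Definition dphi (p x : R) : R := - phi p x * (sinh (p * x) / cosh (p * x)).

Definition d2phi (p x : R) : R := phi p x * (1 - (p + 1) / cosh (p * x) ^ 2).

Lemma is_derive_phi p x : 0 < p -> is_derive (phi p) x (dphi p x).
Proof.
move=> hp; rewrite /dphi /phi /Rpower /cosh /sinh.
have := exp_pos (p * x); have := exp_pos (- (p * x)) => ? ?.
auto_derive; first by split; [lra | split; [apply: Rinv_0_lt_compat; lra | by []]].
rewrite /Rdiv; set E := exp (/ p * _); field; lra.
Qed.

Lemma is_derive_dphi p x : 0 < p -> is_derive (dphi p) x (d2phi p x).
Proof.
move=> hp; rewrite /d2phi /dphi /phi /Rpower /cosh /sinh.
have := exp_pos (p * x); have := exp_pos (- (p * x)) => ? ?.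
auto_derive; first by repeat split; try lra; apply: Rinv_0_lt_compat; lra.
rewrite /Rdiv exp_Ropp; set E := exp (/ p * _).
have ? : 0 < exp (p * x) * exp (p * x) + 1 by nra.
by field; repeat split; lra.
Qed.

Lemma ex_derive_d2phi p x : 0 < p -> ex_derive (d2phi p) x.
Proof.
move=> hp; rewrite /d2phi /phi /Rpower /cosh.
have := exp_pos (p * x); have := exp_pos (- (p * x)) => ? ?.
auto_derive; repeat split; try lra; first by apply: Rinv_0_lt_compat; lra.
by nra.
Qed.

Lemma dphi_opp p x : dphi p (- x) = - dphi p x.
Proof. by rewrite /dphi phi_opp Ropp_mult_distr_r_reverse cosh_opp sinh_opp /Rdiv; ring. Qed.

Lemma Rabs_dphi_le p x : Rabs (dphi p x) <= phi p x.
Proof.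
have := phi_gt0 p x; have hc := cosh_gt0 (p * x); have := Rabs_sinh_le_cosh (p * x) => ? ?.
rewrite /dphi Rabs_mult Rabs_Ropp Rabs_pos_eq; last lra.
rewrite -[X in _ <= X]Rmult_1_r; apply: Rmult_le_compat_l; first lra.
rewrite Rabs_div; last lra.
by rewrite (Rabs_pos_eq (cosh _)); [apply/(Rle_div_l _ _ _ hc); lra | lra].
Qed.

Lemma Rabs_d2phi_le p x : 0 < p -> Rabs (d2phi p x) <= (p + 2) * phi p x.
Proof.
move=> hp; have := phi_gt0 p x; have := cosh_ge1 (p * x) => ? ?.
have hc2 : 1 <= cosh (p * x) ^ 2 by nra.
have hfrac : 0 < (p + 1) / cosh (p * x) ^ 2 <= p + 1.
  split; first by apply: Rdiv_lt_0_compat; lra.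
  by apply/(Rle_div_l _ _ _ (Rlt_le_trans _ _ _ Rlt_0_1 hc2)); nra.
rewrite /d2phi Rabs_mult (Rabs_pos_eq (phi _ _)); last lra.
rewrite Rmult_comm; apply: Rmult_le_compat_r; first lra.
by apply: Rabs_le; lra.
Qed.

Lemma phi_ode p x : 0 < p ->
  - d2phi p x + phi p x - (p + 1) * absPow (phi p x) (2 * p) * phi p x = 0.
Proof.
move=> hp; have := phi_gt0 p x; have := cosh_gt0 (p * x) => ? ?.
have -> : absPow (phi p x) (2 * p) = (/ cosh (p * x)) ^ 2.
  rewrite /absPow; case: Req_EM_T => [?|?]; first lra.
  rewrite Rabs_pos_eq; last lra.
  rewrite /phi Rpower_mult -Rpower_pow; last exact: Rinv_0_lt_compat.
  by congr Rpower; rewrite /=; field; lra.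
by rewrite /d2phi; field; lra.
Qed.

Lemma ex_RInt_gen_nonneg_bounded (h : R -> R) (a M : R) :
  (forall x, continuous h x) -> (forall x, a <= x -> 0 <= h x) ->
  (forall b, a <= b -> RInt h a b <= M) ->
  ex_RInt_gen h (at_point a) (Rbar_locally p_infty).
Proof.
move=> hc hpos hM.
have hex b b' : ex_RInt h b b' by apply: ex_RInt_continuous => ? _; exact: hc.
have mono b b' : a <= b <= b' -> RInt h a b <= RInt h a b'.
  move=> hb; rewrite -(RInt_Chasles h a b b') // /plus /=.
  suff : 0 <= RInt h b b' by lra.
  by apply: RInt_ge_0 => [|//|x hx]; [lra | apply: hpos; lra].
pose E y := exists2 b, a <= b & y = RInt h a b.
have [L [hub hlub]] : {L | is_lub E L}.
  apply: completeness; first by exists M => _ [b hb ->]; exact: hM.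
  by exists (RInt h a a); exists a; [lra |].
exists L => P [eps heps].
have [b0 hab0 hb0] : exists2 b0, a <= b0 & L - eps < RInt h a b0.
  apply: NNPP => hnot; suff : L <= L - eps by have := cond_pos eps; lra.
  apply: hlub => _ [b hb ->]; apply: Rnot_lt_le => hlt; apply: hnot; by exists b.
apply: (Filter_prod _ _ _ (fun x => x = a) (fun b => b0 < b)) => //; first by exists b0.
move=> _ b -> hb; exists (RInt h a b); split; first exact: RInt_correct (hex a b).
have hbL : RInt h a b <= L by apply: hub; exists b => //; lra.
have : RInt h a b0 <= RInt h a b by apply: mono; lra.
move=> ?; apply: heps; rewrite /ball /= /AbsRing_ball /abs /minus /plus /opp /=.
by rewrite Rabs_left1; lra.
Qed.

Lemma RInt_exp_decay (C b : R) :
  RInt (fun x => C * exp (-2 * x)) 0 b = C / 2 * (1 - exp (-2 * b)).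
Proof.
apply: is_RInt_unique.
have -> : C / 2 * (1 - exp (-2 * b)) = - C / 2 * exp (-2 * b) - - C / 2 * exp (-2 * 0).
  by rewrite Rmult_0_r exp_0; field.
apply: (is_RInt_derive (fun x => - C / 2 * exp (-2 * x))) => x _.
- by auto_derive; [|field].
- by apply: continuous_mult; [exact: continuous_const | apply: ex_derive_continuous; auto_derive].
Qed.

Lemma sq_int_exp_bound (g : R -> R) (K : R) :
  (forall x, continuous g x) -> (forall x, 0 <= x -> Rabs (g x) <= K * exp (- x)) ->
  sq_int g.
Proof.
move=> hc hg.
have hcg2 x : continuous (fun y => g y ^ 2) x.
  apply: (continuous_ext (fun y => mult (g y) (g y))) => [y|]; first by rewrite /mult /=; ring.
  by apply: continuous_mult; exact: hc.
have hcexp x : continuous (fun y => K ^ 2 * exp (-2 * y)) x.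
  by apply: ex_derive_continuous; auto_derive.
apply: (ex_RInt_gen_nonneg_bounded (M := K ^ 2 / 2)) => // [x _|b hb]; first exact: pow2_ge_0.
apply: (Rle_trans _ (RInt (fun x => K ^ 2 * exp (-2 * x)) 0 b)).
  apply: RInt_le => // [|| x hx]; try by apply: ex_RInt_continuous.
  rewrite -(pow2_abs (g x)) (_ : exp (-2 * x) = exp (- x) ^ 2) -?Rpow_mult_distr.
    by apply: pow_incr; split; [exact: Rabs_pos | apply: hg; lra].
  by rewrite /= Rmult_1_r -exp_plus; congr exp; ring.
rewrite RInt_exp_decay; have := exp_pos (-2 * b); have := pow2_ge_0 K; nra.
Qed.

Lemma continuous_shift (g : R -> R) (c x : R) :
  continuous g (x + c) -> continuous (fun y => g (y + c)) x.
Proof.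
apply: continuous_comp.
by apply: continuous_plus; [exact: continuous_id | exact: continuous_const].
Qed.

Lemma sq_int_shift (p c K : R) (g : R -> R) : 0 < p ->
  (forall y, continuous g y) -> (forall y, Rabs (g y) <= K * phi p y) ->
  sq_int (fun x => g (x + c)).
Proof.
move=> hp hc hg.
have hK : 0 <= K by have := hg 0; rewrite phi0; have := Rabs_pos (g 0); lra.
apply: (sq_int_exp_bound (K := K * (Rpower 2 (/ p) * exp (- c)))) => [x|x _].
  exact: continuous_shift.
apply: Rle_trans (hg _) _; rewrite Rmult_assoc; apply: Rmult_le_compat_l => //.
by rewrite Rmult_assoc -exp_plus -Ropp_plus_distr Rplus_comm; exact: phi_le_exp.
Qed.

Lemma is_derive_shift (f : R -> R) (c x l : R) :
  is_derive f (x + c) l -> is_derive (fun y => f (y + c)) x l.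
Proof.
move=> hf; have hshift : is_derive (fun y : R => y + c) x 1 by auto_derive; [|ring].
have := is_derive_comp f (fun y => y + c) x _ _ hf hshift.
by rewrite /scal /= /mult /= Rmult_1_l.
Qed.

Lemma filterlim_at_right_continuous (f : R -> R) (x : R) :
  continuous f x -> filterlim f (at_right x) (locally (f x)).
Proof. by move=> hf; apply: filterlim_filter_le_1 hf; exact: filter_le_within. Qed.

Lemma H2_half_phi_shift (p c : R) : 0 < p ->
  H2_half (fun x => phi p (x + c)) (fun x => dphi p (x + c)) (fun x => d2phi p (x + c)).
Proof.
move=> hp.
have cphi y : continuous (phi p) y.
  by apply: ex_derive_continuous; exists (dphi p y); exact: is_derive_phi.
have cdphi y : continuous (dphi p) y.
  by apply: ex_derive_continuous; exists (d2phi p y); exact: is_derive_dphi.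
have cd2phi y : continuous (d2phi p) y by apply: ex_derive_continuous; exact: ex_derive_d2phi.
split; [move=> x _; split | split; [|split; [|split; [|split]]]].
- by apply: is_derive_shift; exact: is_derive_phi.
- by apply: is_derive_shift; exact: is_derive_dphi.
- by apply: filterlim_at_right_continuous; exact: continuous_shift.
- by apply: filterlim_at_right_continuous; exact: continuous_shift.
- apply: (@sq_int_shift p c 1 (phi p)) => // y.
  by rewrite Rmult_1_l Rabs_pos_eq; [exact: Rle_refl | exact/Rlt_le/phi_gt0].
- by apply: (@sq_int_shift p c 1 (dphi p)) => // y; rewrite Rmult_1_l; exact: Rabs_dphi_le.
- by apply: (@sq_int_shift p c (p + 2) (d2phi p)) => // y; exact: Rabs_d2phi_le.
Qed.

HB.instance Definition _ := Monoid.isComLaw.Build R 0 Rplus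
  (fun x y z => esym (Rplus_assoc x y z)) Rplus_comm Rplus_0_l.

Lemma iter_Rplus (k : nat) (v : R) : iter k (Rplus v) 0 = INR k * v.
Proof. by elim: k => [|k IH]; rewrite ?iterS ?IH ?S_INR /=; ring. Qed.

Lemma big_Rplus_signed (T : finType) (S : {set T}) (v : R) : #|S| = #|~: S| ->
  \big[Rplus/0]_(j : T) (if j \in S then v else - v) = 0.
Proof.
move=> hcard; rewrite (bigID (fun j => j \in S)) /=.
rewrite [X in X + _](eq_bigr (fun=> v)) => [|j ->] //.
rewrite [X in _ + X](eq_bigr (fun=> - v)) => [|j /negbTE ->] //.
rewrite [X in _ + X](eq_bigl (fun j => j \in ~: S)) => [|j]; last by rewrite in_setC.
by rewrite !big_const hcard !iter_Rplus; ring.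
Qed.

Lemma state_setC (N : nat) (S : {set 'I_N}) (p a : R) : state (~: S) p a = state S p (- a).
Proof.
apply: functional_extensionality => j; apply: functional_extensionality => x.
by rewrite /state in_setC; case: (j \in S); rewrite /Rminus ?Ropp_involutive.
Qed.

Lemma nls_family_setC (N : nat) (S : {set 'I_N}) (p : R) : nls_family (~: S) p = nls_family S p.
Proof.
apply: functional_extensionality => Psi; apply: propositional_extensionality.
rewrite /nls_family; split=> -[a ->]; exists (- a); rewrite state_setC //.
by rewrite Ropp_involutive.
Qed.

Lemma state_NLS_H2_solution (N : nat) (S : {set 'I_N}) (p a : R) :
  0 < p -> #|S| = #|~: S| -> NLS_H2_solution p (state S p a).
Proof.
move=> hp hcard.
exists (fun j x => if j \in S then dphi p (x + a) else dphi p (x - a)).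
exists (fun j x => if j \in S then d2phi p (x + a) else d2phi p (x - a)).
have phi_vertex : phi p (0 - a) = phi p (0 + a) by rewrite -phi_opp; congr phi; ring.
have dphi_vertex : dphi p (0 - a) = - dphi p (0 + a) by rewrite -dphi_opp; congr dphi; ring.
split; [|split; [|split]].
- by move=> j; rewrite /state; case: (j \in S); exact: H2_half_phi_shift.
- by move=> j k; rewrite /state; case: (j \in S); case: (k \in S); rewrite ?phi_vertex.
- by under eq_bigr do rewrite dphi_vertex; exact: big_Rplus_signed.
- by move=> j x _; rewrite /state; case: (j \in S); exact: phi_ode.
Qed.

Lemma nls_family_inj (N : nat) (S T : {set 'I_N}) (p : R) (i : 'I_N) : 0 < p ->
  i \in S -> i \in T -> nls_family S p = nls_family T p -> S = T.
Proof.
move=> hp hiS hiT hST.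
have [b hb] : nls_family T p (state S p 1) by rewrite -hST; exists 1.
have edge j x : state S p 1 j x = state T p b j x by rewrite hb.
have b1 : b = 1.
  by apply: esym; apply: (phi_shift_inj hp) => x; have := edge i x; rewrite /state hiS hiT.
apply/setP => j; have := edge j; rewrite /state b1.
case: (j \in S); case: (j \in T) => // /(phi_shift_inj hp); lra.
Qed.

Lemma card_halves_containing (T : finType) (i : T) (k : nat) : #|T| = (k + k)%N ->
  (2 * #|[set S : {set T} | (#|S| == k) && (i \in S)]|)%N = 'C(k + k, k).
Proof.
move=> hT; set F := [set S : {set T} | _]; set A := [set S : {set T} | #|S| == k].
have hcardC (S : {set T}) : (#|~: S| == k) = (#|S| == k).
  by have := cardsC S; rewrite hT => hS; apply/eqP/eqP; lia.
have hAF : A :&: F = F by apply/setP => S; rewrite !inE; case: (_ == _).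
have hAnotF : A :\: F = @setC T @: F.
  apply/setP => S; rewrite -[S]setCK (mem_imset _ _ (@setC_inj T)) !inE setCK negbK.
  by rewrite hcardC; case: (_ == _); case: (i \in S).
have := cardsID F A; rewrite hAF hAnotF card_imset; last exact: setC_inj.
by rewrite /A card_draws hT; lia.
Qed.

Theorem lemma3p4 (p : R) (N : nat) :
  (0 < p) -> ~~ odd N -> (0 < N)%N ->
  (forall (S : {set 'I_N}) (a : R), #|S| = N./2 ->
     NLS_H2_solution p (state S p a)) /\
  exists F : {set {set 'I_N}},
    #|F| = (N`! %/ (2 * (N./2)`! ^ 2))%N /\
    (forall S, S \in F -> #|S| = N./2) /\
    (forall S T, S \in F -> T \in F -> nls_family S p = nls_family T p -> S = T) /\
    (forall S : {set 'I_N}, #|S| = N./2 ->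
       exists2 T, T \in F & nls_family S p = nls_family T p).
Proof.
move=> hp hev hN; set k := N./2.
have hNk : N = (k + k)%N by rewrite addnn /k -{1}(odd_double_half N) (negbTE hev).
have hcardC (S : {set 'I_N}) : #|S| = k -> #|~: S| = k.
  by have := cardsC S; rewrite card_ord; lia.
split=> [S a hS|]; first by apply: state_NLS_H2_solution => //; rewrite hcardC.
pose i0 : 'I_N := Ordinal hN.
exists [set S : {set 'I_N} | (#|S| == k) && (i0 \in S)]; split; [|split; [|split]].
- have := card_halves_containing i0 (k := k); rewrite card_ord -hNk => /(_ erefl) hhalf.
  have hfact := bin_fact (leq_addl k k); rewrite addnK -hNk -hhalf in hfact.
  by rewrite -hfact mulnn mulnAC mulKn // muln_gt0 expn_gt0 fact_gt0.
- by move=> S; rewrite inE => /andP [/eqP].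
- by move=> S T; rewrite !inE => /andP [_ hS] /andP [_ hT]; exact: nls_family_inj hp hS hT.
- move=> S hS; case hiS: (i0 \in S).
  + by exists S => //; rewrite inE hS eqxx hiS.
  + by exists (~: S); rewrite ?nls_family_setC // inE in_setC hiS hcardC // eqxx.
Qed.
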